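(* Let $X_1,\ldots,X_n$ be i.i.d. from $P_\theta$, where the scalar-parameter model $\{P_\theta\}$ is differentiable in quadratic mean at $\theta=0$ with Fisher information $I_0$ at $0$ satisfying $0<I_0<\infty$. Let $\Delta_n>0$ be such that $\lambda_n=\sqrt{nI_0}\,\Delta_n\to0$, and fix $\varepsilon\in(0,1)$. Let $$\mathcal N_n(\varepsilon)=\{\theta:|\theta|\le(1-\varepsilon)\Delta_n\},\qquad \mathcal M_n(\varepsilon)=\{\theta:|\theta|\ge(1+\varepsilon)\Delta_n\},$$ $$R_n^*=\inf_{\phi_n}\Big\{\sup_{\theta\in\mathcal N_n(\varepsilon)}E_\theta\phi_n+\sup_{\theta\in\mathcal M_n(\varepsilon)}E_\theta(1-\phi_n)\Big\},$$ the infimum being over measurable $\phi_n=\phi_n(X_1,\ldots,X_n)\in[0,1]$. Then: (i) $R_n^*\to1$. (ii) For $\theta_n=(1+\varepsilon)\Delta_n$, $\|P_{\theta_n}^n-P_0^n\|_{\mathrm{TV}}\to0$. (iii) With $b_n=(\sqrt n\,\Delta_n)^{-1/2}$ and $\theta_n=b_n\Delta_n$, one has $|\theta_n|/\Delta_n\to\infty$ and yet $\|P_{\theta_n}^n-P_0^n\|_{\mathrm{TV}}\to0$.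
   Context: $P_\theta^n$ is the $n$-fold product of $P_\theta$, and $\|P-Q\|_{\mathrm{TV}}=\sup_A|P(A)-Q(A)|$. The model $\{P_\theta\}$ is indexed by a real parameter set containing a neighborhood of $0$; $\mathcal N_n(\varepsilon)$, $\mathcal M_n(\varepsilon)$ are subsets of that parameter set. $E_\theta$ denotes expectation under $P_\theta^n$. Differentiability in quadratic mean at $0$: with densities $p_\theta$ with respect to dominating measures, there is a score function $\dot\ell$ with $\int(\sqrt{p_h}-\sqrt{p_0}-\tfrac12 h\dot\ell\sqrt{p_0})^2=o(h^2)$ as $h\to0$, and $I_0=E_{P_0}\dot\ell^2$. *)

(* Defs.v *)
From HB Require Import structures.
From mathcomp Require Import all_boot all_order all_algebra.
From mathcomp Require Import all_classical all_reals all_analysis.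

Set Implicit Arguments.
Unset Strict Implicit.
Unset Printing Implicit Defensive.

Import Order.TTheory GRing.Theory Num.Theory.
Import numFieldNormedType.Exports.

Local Open Scope classical_set_scope.
Local Open Scope ring_scope.

Section product_power.
Context (d : measure_display) (T : measurableType d) (R : realType).

Definition tuple_cons (n : nat) (x : T * n.-tuple T) : n.+1.-tuple T :=
  [tuple of x.1 :: x.2].

Lemma measurable_tuple_cons (n : nat) : measurable_fun setT (@tuple_cons n).
Proof. exact: measurable_cons measurable_fst measurable_snd. Qed.

HB.instance Definition _ (n : nat) :=
  isMeasurableFun.Build _ _ _ _ (@tuple_cons n) (@measurable_tuple_cons n).

(* The n-fold product P x ... x P on n-tuples, whose sigma-algebra is the one
   generated by the coordinate maps; the 0-fold product is the unique
   probability on the one-point space.  [power_measure_box] below is its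
   characteristic property. *)
Fixpoint power_measure (P : probability T R) (n : nat) :
    probability (n.-tuple T) R :=
  match n with
  | 0 => \d_([tuple])
  | n'.+1 => distribution (P \x power_measure P n')%E (@tuple_cons n')
  end.

Lemma power_measure_box (P : probability T R) (n : nat) (A : 'I_n -> set T) :
  (forall i, measurable (A i)) ->
  power_measure P n [set t | forall i, A i (tnth t i)] =
  (\prod_(i < n) P (A i))%E.
Proof.
elim: n A => [|n IHn] A mA.
  rewrite big_ord0 /= diracE mem_set//=.
  by case.
transitivity ((P \x power_measure P n)%E
      (A ord0 `*` [set t | forall i, A (lift ord0 i) (tnth t i)])).
  rewrite [LHS]/= /distribution /pushforward; congr (product_measure1 _ _ _).
  apply/seteqP; split => -[x t] /=.
    move=> At; split; first exact: (At ord0).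
    by move=> i; have := At (lift ord0 i); rewrite tnthS.
  move=> [A0 At] i; case: (unliftP ord0 i) => [j ->|->]; last exact: A0.
  by rewrite tnthS; exact: At.
rewrite product_measure1E//.
  rewrite big_ord_recl; congr (_ * _)%E.
  exact: (IHn (fun i => A (lift ord0 i))).
have -> : [set t : n.-tuple T | forall i, A (lift ord0 i) (tnth t i)] =
    \bigcap_(i in [set: 'I_n])
      ((fun t : n.-tuple T => tnth t i) @^-1` A (lift ord0 i)).
  by apply/seteqP; split => t /= At i; [move=> _|]; exact: At.
apply: fin_bigcap_measurable; first exact: finite_finset.
move=> i _; rewrite -[X in measurable X]setTI.
exact: measurable_tnth.
Qed.

End product_power.

Section statistical_model.
Context (d : measure_display) (T : measurableType d) (R : realType).

Definition is_density (mu : {measure set T -> \bar R}) (P : probability T R)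
    (p : T -> R) : Prop :=
  [/\ measurable_fun setT p,
      (forall x, 0 <= p x) &
      forall A, measurable A -> P A = (\int[mu]_(x in A) (p x)%:E)%E].

(* The model need not be dominated: for each h, P_h and P_0 have densities
   p h and p0 h with respect to a measure mu h which may depend on h. *)
Definition quadratic_mean_differentiable_at0 (Theta : set R)
    (P : R -> probability T R) (score : T -> R) : Prop :=
  measurable_fun setT score /\
  exists (mu : R -> {measure set T -> \bar R}) (p p0 : R -> T -> R),
    (forall h, Theta h ->
       is_density (mu h) (P h) (p h) /\ is_density (mu h) (P 0) (p0 h)) /\
    ((h ^- 2)%:E *
       \int[mu h]_x ((Num.sqrt (p h x) - Num.sqrt (p0 h x)
          - 2^-1 * h * score x * Num.sqrt (p0 h x)) ^+ 2)%:E)%E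
      @[h --> 0^'] --> 0%E.

Definition fisher_information (P0 : probability T R) (score : T -> R) : \bar R :=
  ('E_P0[fun x => (score x ^+ 2)%R])%E.

Definition near_null (Theta : set R) (eps Delta : R) : set R :=
  [set theta | Theta theta /\ `|theta| <= (1 - eps) * Delta].

Definition far_alternative (Theta : set R) (eps Delta : R) : set R :=
  [set theta | Theta theta /\ `|theta| >= (1 + eps) * Delta].

Definition randomized_test (n : nat) (phi : n.-tuple T -> R) : Prop :=
  measurable_fun setT phi /\ forall x, 0 <= phi x <= 1.

Definition minimax_risk (P : R -> probability T R) (n : nat)
    (null alt : set R) : \bar R :=
  ereal_inf [set
    (ereal_sup [set 'E_(power_measure (P theta) n)[phi] | theta in null] +
     ereal_sup [set 'E_(power_measure (P theta) n)[fun x => (1 - phi x)%R]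
                | theta in alt])%E
    | phi in @randomized_test n].

End statistical_model.

Definition tv_dist (d : measure_display) (T : measurableType d) (R : realType)
    (P Q : probability T R) : \bar R :=
  ereal_sup [set (`|P A - Q A|)%E | A in measurable].

(* Main.v *)
Require Import Defs.
From HB Require Import structures.
From mathcomp Require Import all_boot all_order all_algebra.
From mathcomp Require Import all_classical all_reals all_analysis.
From mathcomp Require Import measurable_realfun.
From mathcomp Require Import ring lra.

Import Order.TTheory GRing.Theory Num.Theory.
Import numFieldNormedType.Exports.

Local Open Scope classical_set_scope.
Local Open Scope ring_scope.

(** If f g >= 1 then, by Cauchy-Schwarz, (\int f dP) (\int g dQ) is at least the
    squared Hellinger affinity of P and Q, and the affinity is the best constant.
    Taking this duality as the definition of a lower bound on the affinity, the
    bound tensorizes by Fubini, without densities of the product measures, and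
    it controls |E_P phi - E_Q phi| for every test phi.  Quadratic mean
    differentiability gives a squared Hellinger distance H^2 (P_h, P_0) <= C h^2
    near 0, so that the squared affinity of the n-fold products is at least
    (1 - C h^2 / 2)^(2n) >= 1 - n C h^2, which tends to 1 as soon as
    sqrt n h -> 0.  The risk bound is Le Cam's two-point argument with the
    parameters 0 and (1 + eps) Delta_n. *)

(** * Elementary inequalities for real numbers *)

(** The infimum of [s * x + y / s] over [s > 0] is [2 sqrt(x y)]. Affinity bounds arise as families
    indexed by such an [s], which is eliminated here. *)
Lemma amgm_le {R : realType} (x y k : R) : 0 <= x -> 0 <= y ->
  (forall s : R, 0 < s -> k <= s * x + s^-1 * y) ->
  k <= 2 * (Num.sqrt x * Num.sqrt y).
Proof.
move=> x0 y0 H; apply/ler_addgt0Pr => e e0.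
have [a0 b0] := (sqrtr_ge0 x, sqrtr_ge0 y).
have := sqr_sqrtr x0; have := sqr_sqrtr y0; rewrite !expr2.
move: (Num.sqrt x) (Num.sqrt y) a0 b0 => a b a0 b0 by_ ax.
pose r := e / (a + b + 1).
have ab1 : 0 < a + b + 1 by lra.
have r0 : 0 < r by rewrite divr_gt0.
have rE : r * (a + b + 1) = e by rewrite /r divfK ?gt_eqF.
(* The optimal s is b / a; the perturbation r avoids a division by 0. *)
have := H ((b + r) / (a + r)) (divr_gt0 (ltr_wpDl b0 r0) (ltr_wpDl a0 r0)).
move=> /le_trans; apply.
have ar : 0 < a + r by lra.
have br : 0 < b + r by lra.
have h1 : (b + r) / (a + r) * x <= (b + r) * a.
  rewrite mulrAC ler_pdivrMr// -mulrA ler_pM2l// -ax; nra.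
have h2 : ((b + r) / (a + r))^-1 * y <= (a + r) * b.
  rewrite invf_div mulrAC ler_pdivrMr// -mulrA ler_pM2l// -by_; nra.
nra.
Qed.

(** Minimized over [s], the hypothesis says that [c] is at most the squared affinity of the
    Bernoulli laws with parameters [a] and [b]. What follows is the classical bound of squared total
    variation by one minus squared affinity, for these two laws. *)
Lemma affinity_sqr_dist_le {R : realType} (a b c : R) :
  0 <= a <= 1 -> 0 <= b <= 1 ->
  (forall s : R, 0 < s -> c <= (s * a + (1 - a)) * (s^-1 * b + (1 - b))) ->
  (a - b) ^+ 2 <= 1 - c.
Proof.
move=> /andP[a0 a1] /andP[b0 b1] H.
have x0 : 0 <= a * (1 - b) by rewrite mulr_ge0// subr_ge0.
have y0 : 0 <= (1 - a) * b by rewrite mulr_ge0// subr_ge0.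
have : c - a * b - (1 - a) * (1 - b) <=
    2 * (Num.sqrt (a * (1 - b)) * Num.sqrt ((1 - a) * b)).
  apply: amgm_le => // s s0; have := H s s0.
  have -> : (s * a + (1 - a)) * (s^-1 * b + (1 - b)) =
      (s * s^-1) * (a * b) + (1 - a) * (1 - b) +
      (s * (a * (1 - b)) + s^-1 * ((1 - a) * b)) by ring.
  by rewrite divff ?gt_eqF//; lra.
have := sqr_sqrtr x0; have := sqr_sqrtr y0.
have := sqrtr_ge0 (a * (1 - b)); have := sqrtr_ge0 ((1 - a) * b).
move: (Num.sqrt (a * (1 - b))) (Num.sqrt ((1 - a) * b)) => u v v0 u0 vE uE H'.
(* Since [a b + (1 - a)(1 - b) = 1 - u^2 - v^2], [H'] says [(u - v)^2 <= 1 - c]. As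
   [a - b = (u - v)(u + v)], a bound on [u + v] suffices. *)
have uv1 : (u + v) ^+ 2 <= 1.
  have : (u * v) ^+ 2 = (a * (1 - a)) * (b * (1 - b)).
    by rewrite exprMn uE vE; ring.
  have := sqr_ge0 (a * (1 - a) - b * (1 - b)).
  have ha : 0 <= a * (1 - a) by rewrite mulr_ge0// subr_ge0.
  have hb : 0 <= b * (1 - b) by rewrite mulr_ge0// subr_ge0.
  move=> h1 h2.
  have : 2 * (u * v) <= a * (1 - a) + b * (1 - b).
    rewrite -(@ler_pXn2r _ 2)// ?nnegrE ?mulr_ge0 ?addr_ge0//.
    rewrite exprMn h2; lra.
  (* Adding [u^2 + v^2 = a + b - 2 a b] gives [(u + v)^2 <= 1 - (a + b - 1)^2]. *)
  by have := sqr_ge0 (a + b - 1); rewrite !expr2 in uE vE *; lra.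
have -> : (a - b) ^+ 2 = (u - v) ^+ 2 * (u + v) ^+ 2.
  have -> : a - b = u ^+ 2 - v ^+ 2 by rewrite uE vE; ring.
  by rewrite subr_sqr exprMn.
apply: (@le_trans _ _ ((u - v) ^+ 2)); first by rewrite ler_piMr ?sqr_ge0.
rewrite !expr2 in uE vE *; nra.
Qed.

(** * Integration against a density *)

Import HBNNSimple.

(** For indicators this is the defining property of a density; linearity extends it to simple
    functions, and monotone convergence on both sides to nonnegative [f]. *)
Lemma integral_density {d} {T : measurableType d} {R : realType}
    {mu : {measure set T -> \bar R}} {P : probability T R} {p : T -> R}
    (f : T -> \bar R) :
  is_density mu P p -> measurable_fun setT f -> (forall x, 0 <= f x)%E ->
  (\int[P]_x f x = \int[mu]_x (f x * (p x)%:E))%E.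
Proof.
move=> [mp p0 Pp] mf f0.
pose h := nnsfun_approx measurableT mf.
have hf x : (EFin \o h ^~ x) n @[n --> \oo] --> f x.
  by apply: cvg_nnsfun_approx.
have mEp : measurable_fun setT (EFin \o p) by exact/measurable_EFinP.
have -> : (\int[P]_x f x = lim (\int[P]_x (EFin \o h n) x @[n --> \oo]))%E.
  under eq_integral do rewrite -(cvg_lim _ (hf _))//.
  apply: monotone_convergence => //.
  - by move=> n; exact/measurable_EFinP.
  - by move=> n x _ //=; rewrite lee_fin.
  - by move=> x _ a b ab; rewrite lee_fin; exact/lefP/nd_nnsfun_approx.
have -> : (\int[mu]_x (f x * (p x)%:E) =
    lim (\int[mu]_x ((EFin \o h n) x * (p x)%:E) @[n --> \oo]))%E.
  have hfp x : ((EFin \o h n) x * (p x)%:E)%E @[n --> \oo] --> (f x * (p x)%:E)%E.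
    by apply: cvgeZr => //; exact: hf.
  under eq_integral do rewrite -(cvg_lim _ (hfp _))//.
  apply: monotone_convergence => //.
  - by move=> n; apply: emeasurable_funM => //; exact/measurable_EFinP.
  - by move=> n x _ //=; rewrite mule_ge0// lee_fin.
  - move=> x _ a b ab; rewrite lee_wpmul2r ?lee_fin//.
    exact/lefP/nd_nnsfun_approx.
congr (lim (_ @ \oo)); apply/funext => n.
rewrite /comp; under [LHS]eq_integral do rewrite fimfunE -fsumEFin//.
have mind r : measurable_fun setT (fun x => (r * \1_(h n @^-1` [set r]) x)%:E).
  by apply/measurable_EFinP; exact: measurable_funM.
rewrite ge0_integral_fsum//; last by move=> r x _; exact: nnfun_muleindic_ge0.
under [RHS]eq_integral => x _.
  rewrite fimfunE -fsumEFin// ge0_mule_fsuml => [|r]; last first.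
    exact: nnfun_muleindic_ge0.
  over.
rewrite ge0_integral_fsum//; last 2 first.
- by move=> r; exact: emeasurable_funM.
- by move=> r x _; apply: mule_ge0; [exact: nnfun_muleindic_ge0|rewrite lee_fin].
(* One term per value [r] of the simple function. As [r] is attained it is nonnegative and can be
   pulled out of both integrals, leaving the level set. *)
apply: eq_fsbigr => r /[!inE] -[t _ rE].
have r0 : 0 <= r by rewrite -rE.
have mA : measurable (h n @^-1` [set r]) by [].
under eq_integral do rewrite EFinM.
under [RHS]eq_integral do rewrite EFinM -muleA.
rewrite ge0_integralZl_EFin ?ge0_integralZl_EFin//.
- congr (_ * _)%E; rewrite integral_indic// setIT.
  transitivity (P (h n @^-1` [set r])) => //.
  rewrite (Pp _ mA) integral_mkcond; apply: eq_integral => x _.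
  by rewrite epatch_indic muleC.
- by move=> x _; rewrite mule_ge0 ?lee_fin.
- by apply: emeasurable_funM => //; exact/measurable_EFinP.
- exact/measurable_EFinP.
Qed.

(** * Affinity bounds and their tensorization *)

(* Equivalent, for every c, to: the squared Hellinger affinity of P and Q is at
   least c.  Up to scaling K is 1, but a general K lets the inner integrals of
   a double integral serve as a new pair (f, g). *)
Definition affinity_sqr_ge {d} {T : measurableType d} {R : realType}
    (P Q : probability T R) (c : R) : Prop :=
  forall (M K : R) (f g : T -> \bar R), 0 <= K ->
    measurable_fun setT f -> measurable_fun setT g ->
    (forall x, 0 <= f x <= M%:E)%E -> (forall x, 0 <= g x <= M%:E)%E ->
    (forall x, K%:E <= f x * g x)%E ->
    ((c * K)%:E <= \int[P]_x f x * \int[Q]_x g x)%E.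

(** Used to keep integrals finite, and to pass the bound [M] on to the inner integrals of a double
    integral. *)
Lemma integral_bounded {d} {T : measurableType d} {R : realType}
    (P : probability T R) {M : R} {f : T -> \bar R} :
  measurable_fun setT f -> (forall x, 0 <= f x <= M%:E)%E ->
  (0 <= \int[P]_x f x <= M%:E)%E.
Proof.
move=> mf f0M; have f0 x : (0 <= f x)%E by have /andP[] := f0M x.
rewrite integral_ge0//=.
rewrite -[leRHS]mule1 -(@probability_setT _ _ _ P) -integral_cst//.
by apply: ge0_le_integral => //= x _; have /andP[] := f0M x.
Qed.

(** By Fubini and [A2], the inner integrals of [f] and [g] have pointwise product at least [c2 * K];
    they are then a valid pair for [A1], with [c2 * K] in the role of [K]. *)
Lemma affinity_sqr_ge_prod {d1 d2} {T1 : measurableType d1}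
    {T2 : measurableType d2} {R : realType} (P1 Q1 : probability T1 R)
    (P2 Q2 : probability T2 R) (c1 c2 : R) (M K : R) (f g : T1 * T2 -> \bar R) :
  affinity_sqr_ge P1 Q1 c1 -> affinity_sqr_ge P2 Q2 c2 -> 0 <= c2 -> 0 <= K ->
  measurable_fun setT f -> measurable_fun setT g ->
  (forall x, 0 <= f x <= M%:E)%E -> (forall x, 0 <= g x <= M%:E)%E ->
  (forall x, K%:E <= f x * g x)%E ->
  ((c1 * c2 * K)%:E <= \int[P1 \x P2]_x f x * \int[Q1 \x Q2]_x g x)%E.
Proof.
move=> A1 A2 c20 K0 mf mg f0M g0M Kfg.
have f0 x : (0 <= f x)%E by have /andP[] := f0M x.
have g0 x : (0 <= g x)%E by have /andP[] := g0M x.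
rewrite !fubini_tonelli1// -mulrA.
have mfx x : measurable_fun setT (fun y => f (x, y)).
  by apply: measurableT_comp => //; exact: pair1_measurable.
have mgx x : measurable_fun setT (fun y => g (x, y)).
  by apply: measurableT_comp => //; exact: pair1_measurable.
apply: (A1 M); first by rewrite mulr_ge0.
- exact: measurable_fun_fubini_tonelli_F.
- exact: measurable_fun_fubini_tonelli_F.
- by move=> x; apply: integral_bounded.
- by move=> x; apply: integral_bounded.
- by move=> x; apply: (A2 M).
Qed.

(** Induction on [n], integrals being pulled back along [tuple_cons] to the product of one factor
    and the [n]-fold power. For [n = 0] both measures are the same Dirac mass, and the claim is the
    pointwise bound [Kfg]. *)
Lemma affinity_sqr_ge_power {d} {T : measurableType d} {R : realType}
    (P Q : probability T R) (c : R) (n : nat) :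
  0 <= c -> affinity_sqr_ge P Q c ->
  affinity_sqr_ge (power_measure P n) (power_measure Q n) (c ^+ n).
Proof.
move=> c0 A; elim: n => [|n IH] M K f g K0 mf mg f0M g0M Kfg.
  by rewrite /= !integral_dirac// diracT !mul1e expr0 mul1r.
have f0 x : (0 <= f x)%E by have /andP[] := f0M x.
have g0 x : (0 <= g x)%E by have /andP[] := g0M x.
rewrite /= !ge0_integral_distribution// exprS.
by apply: (@affinity_sqr_ge_prod _ _ _ _ _ _ _ _ _ _ _ M) => //=;
  [exact: exprn_ge0|exact: measurableT_comp|exact: measurableT_comp].
Qed.

(** * From Hellinger distance to affinity *)

(** Here [k (u^2 + v^2) = 2 k u v + k (u - v)^2], and AM-GM bounds [2 k u v]. It is integrated with
    [u], [v] the square roots of two densities, so that the last term becomes a squared Hellinger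
    distance. *)
Lemma weighted_amgm {R : realFieldType} (k s a b u v : R) :
  0 < s -> 0 <= a -> 0 <= b -> 0 <= u -> 0 <= v -> k ^+ 2 <= a * b ->
  k * (u ^+ 2 + v ^+ 2) <=
  s * (a * u ^+ 2) + s^-1 * (b * v ^+ 2) + k * (u - v) ^+ 2.
Proof.
move=> s0 a0 b0 u0 v0 kab.
have sV0 : 0 <= s^-1 by rewrite invr_ge0 ltW.
set x := s * _; set y := s^-1 * _.
have x0 : 0 <= x by rewrite !mulr_ge0 ?sqr_ge0// ltW.
have y0 : 0 <= y by rewrite !mulr_ge0 ?sqr_ge0.
have xy : x * y = a * b * (u * v) ^+ 2.
  transitivity (s * s^-1 * (a * b * (u * v) ^+ 2)); first by rewrite /x /y; ring.
  by rewrite divff ?mul1r ?gt_eqF.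
have : (2 * (k * (u * v))) ^+ 2 <= (x + y) ^+ 2.
  have : (k * (u * v)) ^+ 2 <= x * y by rewrite xy exprMn ler_wpM2r ?sqr_ge0.
  have := sqr_ge0 (x - y); rewrite exprMn; lra.
case: (leP 0 (k * (u * v))) => kuv; last by lra.
by rewrite ler_pXn2r ?nnegrE ?addr_ge0 ?(mulr_ge0 _ kuv)//; lra.
Qed.

(** With the unnormalized squared Hellinger distance at most [e], the affinity is at least
    [1 - e / 2]; the dual form comes from integrating [weighted_amgm] and optimizing over [s]. *)
Lemma affinity_sqr_ge_density {d} {T : measurableType d} {R : realType}
    {mu : {measure set T -> \bar R}} {P Q : probability T R} {p q : T -> R}
    {e : R} : is_density mu P p -> is_density mu Q q -> e <= 2 ->
  (\int[mu]_x ((Num.sqrt (p x) - Num.sqrt (q x)) ^+ 2)%:E <= e%:E)%E ->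
  affinity_sqr_ge P Q ((1 - e / 2) ^+ 2).
Proof.
move=> dP dQ e2 He M K f g K0 mf mg f0M g0M Kfg.
have [mp p0 Pp] := dP; have [mq q0 Qq] := dQ.
have f0 x : (0 <= f x)%E by have /andP[] := f0M x.
have g0 x : (0 <= g x)%E by have /andP[] := g0M x.
have ffin x : f x \is a fin_num.
  by rewrite ge0_fin_numE//; have /andP[_ /le_lt_trans ->] := f0M x; rewrite ?ltry.
have gfin x : g x \is a fin_num.
  by rewrite ge0_fin_numE//; have /andP[_ /le_lt_trans ->] := g0M x; rewrite ?ltry.
have /andP[A0 AM] := integral_bounded P mf f0M.
have /andP[B0 BM] := integral_bounded Q mg g0M.
have mp' : measurable_fun setT (EFin \o p) by exact/measurable_EFinP.
have mq' : measurable_fun setT (EFin \o q) by exact/measurable_EFinP.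
have mh : measurable_fun setT
    (fun x => ((Num.sqrt (p x) - Num.sqrt (q x)) ^+ 2)%:E).
  apply/measurable_EFinP; apply: measurable_funX; apply: measurable_funB;
    apply: measurableT_comp => //; apply: continuous_measurable_fun;
    exact: sqrt_continuous.
have key (s : R) : 0 < s -> ((Num.sqrt K * 2)%:E <=
    s%:E * \int[P]_x f x + s^-1%:E * \int[Q]_x g x + (Num.sqrt K * e)%:E)%E.
  move=> s0.
  have mfp : measurable_fun setT (fun x => f x * (p x)%:E)%E.
    exact: emeasurable_funM.
  have mgq : measurable_fun setT (fun x => g x * (q x)%:E)%E.
    exact: emeasurable_funM.
  have fp0 x : (0 <= f x * (p x)%:E)%E by rewrite mule_ge0 ?lee_fin.
  have gq0 x : (0 <= g x * (q x)%:E)%E by rewrite mule_ge0 ?lee_fin.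
  have sV0 : 0 <= s^-1 by rewrite invr_ge0 ltW.
  (* The factor 2 is the total mass of [p + q]. *)
  apply: (@le_trans _ _ (\int[mu]_x ((Num.sqrt K)%:E * ((p x)%:E + (q x)%:E)))%E).
    have mpq : measurable_fun setT (fun x => (p x)%:E + (q x)%:E)%E.
      exact: emeasurable_funD.
    have pq0 x : setT x -> (0 <= (p x)%:E + (q x)%:E)%E.
      by rewrite adde_ge0 ?lee_fin.
    rewrite (ge0_integralZl_EFin mu measurableT pq0 mpq (sqrtr_ge0 K)).
    rewrite ge0_integralD//; do ?by move=> x _; rewrite lee_fin.
    by rewrite -(Pp setT)// -(Qq setT)// !probability_setT -EFinD -EFinM.
  apply: (@le_trans _ _ (\int[mu]_x (s%:E * (f x * (p x)%:E) +
     s^-1%:E * (g x * (q x)%:E) +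
     (Num.sqrt K)%:E * ((Num.sqrt (p x) - Num.sqrt (q x)) ^+ 2)%:E))%E).
    apply: ge0_le_integral => //.
    - by move=> x _; rewrite mule_ge0 ?lee_fin ?sqrtr_ge0// addr_ge0.
    - by apply: emeasurable_funM => //; exact: emeasurable_funD.
    - by do 2 ?apply: emeasurable_funD; apply: emeasurable_funM.
    - move=> x _; have := Kfg x; have := f0 x; have := g0 x.
      rewrite -(fineK (ffin x)) -(fineK (gfin x)) -!EFinM -!EFinD !lee_fin.
      move: (fine (f x)) (fine (g x)) => a b b0 a0 ab.
      rewrite -[in leLHS](sqr_sqrtr (p0 x)) -[in leLHS](sqr_sqrtr (q0 x)).
      rewrite -[a * p x](congr1 ( *%R a) (sqr_sqrtr (p0 x))).
      rewrite -[b * q x](congr1 ( *%R b) (sqr_sqrtr (q0 x))).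
      by apply: weighted_amgm => //; rewrite ?sqrtr_ge0// sqr_sqrtr.
  have mh' : measurable_fun setT (fun x => (Num.sqrt K)%:E *
      ((Num.sqrt (p x) - Num.sqrt (q x)) ^+ 2)%:E)%E by exact: emeasurable_funM.
  have h0 x : (0 <= ((Num.sqrt (p x) - Num.sqrt (q x)) ^+ 2)%:E)%E.
    by rewrite lee_fin sqr_ge0.
  have msfp : measurable_fun setT (fun x => s%:E * (f x * (p x)%:E))%E.
    exact: emeasurable_funM.
  have msgq : measurable_fun setT (fun x => s^-1%:E * (g x * (q x)%:E))%E.
    exact: emeasurable_funM.
  have sfp0 x : (0 <= s%:E * (f x * (p x)%:E))%E by rewrite mule_ge0 ?lee_fin// ltW.
  have sgq0 x : (0 <= s^-1%:E * (g x * (q x)%:E))%E by rewrite mule_ge0 ?lee_fin.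
  rewrite ge0_integralD//; last 3 first.
  - by move=> x _; rewrite adde_ge0.
  - exact: emeasurable_funD.
  - by move=> x _; rewrite mule_ge0 ?h0// lee_fin sqrtr_ge0.
  rewrite ge0_integralD// !ge0_integralZl_EFin ?sqrtr_ge0 ?(ltW s0)//.
  rewrite -(integral_density f dP)// -(integral_density g dQ)// leeD2l//.
  by rewrite EFinM lee_wpmul2l ?lee_fin ?sqrtr_ge0.
have Afin : (\int[P]_x f x)%E \is a fin_num.
  by rewrite ge0_fin_numE// (le_lt_trans AM) ?ltry.
have Bfin : (\int[Q]_x g x)%E \is a fin_num.
  by rewrite ge0_fin_numE// (le_lt_trans BM) ?ltry.
move: A0 B0 key; rewrite -(fineK Afin) -(fineK Bfin) -EFinM !lee_fin.
move: (fine _) (fine _) => B A A0' B0' key.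
(* Optimizing over [s] leaves an inequality between square roots; [e <= 2] makes its left side
   nonnegative, so it can be squared. *)
have : Num.sqrt K * (2 - e) <= 2 * (Num.sqrt A * Num.sqrt B).
  by apply: amgm_le => // s s0; have := key s s0; rewrite -!EFinM -!EFinD lee_fin; lra.
move=> le_sqrt.
rewrite -(sqr_sqrtr K0) -(sqr_sqrtr A0') -(sqr_sqrtr B0') -!exprMn.
have := sqrtr_ge0 K; have := sqrtr_ge0 A; have := sqrtr_ge0 B => b0 a0 k0.
by rewrite ler_pXn2r ?nnegrE ?mulr_ge0//; lra.
Qed.

(** * Tests and total variation *)

Lemma integral_mix {d} {T : measurableType d} {R : realType}
    (P : probability T R) {phi : T -> R} {a b : R} :
  measurable_fun setT phi -> (forall x, 0 <= phi x <= 1) -> 0 <= a -> 0 <= b ->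
  (\int[P]_x (a * phi x + b * (1 - phi x))%:E =
   (a * fine 'E_P[phi] + b * (1 - fine 'E_P[phi]))%:E)%E.
Proof.
move=> mphi phi01 a0 b0.
have mE : measurable_fun setT (EFin \o phi) by exact/measurable_EFinP.
have mE' : measurable_fun setT (fun x => (1 - phi x)%:E).
  by apply/measurable_EFinP; exact: measurable_funB.
have phi0 x : (0 <= (phi x)%:E)%E by rewrite lee_fin; have /andP[] := phi01 x.
have phi1 x : (0 <= (1 - phi x)%:E)%E.
  by rewrite lee_fin subr_ge0; have /andP[] := phi01 x.
have /andP[E0 E1] : (0 <= \int[P]_x (phi x)%:E <= 1%:E)%E.
  by apply: integral_bounded => // x; rewrite !lee_fin.
have Efin : (\int[P]_x (phi x)%:E)%E \is a fin_num.
  by rewrite ge0_fin_numE// (le_lt_trans E1) ?ltry.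
have onemE : (\int[P]_x (1 - phi x)%:E = (1 - fine (\int[P]_x (phi x)%:E))%:E)%E.
  rewrite EFinB fineK//; suff <- : (\int[P]_x (1 - phi x)%:E +
      \int[P]_x (phi x)%:E = 1)%E by rewrite addeK.
  rewrite -ge0_integralD// -(@probability_setT _ _ _ P) -[RHS]mul1e.
  by rewrite -integral_cst//; apply: eq_integral => x _; rewrite -EFinD subrK.
rewrite expectation.unlock [RHS]EFinD !EFinM -onemE fineK//.
rewrite -!ge0_integralZl_EFin// -ge0_integralD//.
- by move=> x _; apply: mule_ge0.
- exact: emeasurable_funM.
- by move=> x _; apply: mule_ge0.
- exact: emeasurable_funM.
Qed.

Lemma expectation_test {d} {T : measurableType d} {R : realType}
    (P : probability T R) {phi : T -> R} :
  measurable_fun setT phi -> (forall x, 0 <= phi x <= 1) ->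
  exists2 a : R, 0 <= a <= 1 &
    ('E_P[phi] = a%:E /\ 'E_P[fun x => (1 - phi x)%R] = (1 - a)%:E)%E.
Proof.
move=> mphi phi01; exists (fine 'E_P[phi])%E; last split.
- rewrite expectation.unlock.
  have /andP[E0 E1] : (0 <= \int[P]_x (phi x)%:E <= 1%:E)%E.
    by apply: integral_bounded => //; exact/measurable_EFinP.
  by rewrite fine_ge0//= -lee_fin fineK// ge0_fin_numE// (le_lt_trans E1) ?ltry.
- have := integral_mix P mphi phi01 ler01 (lexx 0).
  rewrite mul0r addr0 mul1r => <-; rewrite expectation.unlock.
  by apply: eq_integral => x _; rewrite mul1r mul0r addr0.
- have := integral_mix P mphi phi01 (lexx 0) ler01.
  rewrite mul0r add0r mul1r => <-; rewrite expectation.unlock.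
  by apply: eq_integral => x _; rewrite mul0r add0r mul1r.
Qed.

(* Feed the pair f = s phi + (1 - phi), g = phi / s + (1 - phi), for which
   f g >= 1 by Cauchy-Schwarz, to the affinity bound. *)
Lemma affinity_sqr_ge_test {d} {T : measurableType d} {R : realType}
    {P Q : probability T R} {c : R} {phi : T -> R} :
  affinity_sqr_ge P Q c ->
  measurable_fun setT phi -> (forall x, 0 <= phi x <= 1) ->
  (`|'E_P[phi] - 'E_Q[phi]| <= (Num.sqrt (1 - c))%:E)%E.
Proof.
move=> A mphi phi01.
have [a a01 [aE _]] := expectation_test P mphi phi01.
have [b b01 [bE _]] := expectation_test Q mphi phi01.
rewrite aE bE -EFinB lee_fin.
have le_c : (a - b) ^+ 2 <= 1 - c.
  apply: affinity_sqr_dist_le => // s s0.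
  have sV0 : 0 < s^-1 by rewrite invr_gt0.
  have ssV : s * s^-1 = 1 by rewrite divff ?gt_eqF.
  have mmix (r : R) : measurable_fun setT
      (fun x => (r * phi x + 1 * (1 - phi x))%:E).
    apply/measurable_EFinP; apply: measurable_funD; apply: measurable_funM => //.
    exact: measurable_funB.
  have bmix (r : R) : 0 < r -> r <= s + s^-1 -> forall x,
      (0 <= (r * phi x + 1 * (1 - phi x))%:E <= (s + s^-1 + 1)%:E)%E.
    by move=> r0 rs x; rewrite !lee_fin; have /andP[] := phi01 x; nra.
  have := A (s + s^-1 + 1) 1 _ _ ler01 (mmix s) (mmix s^-1).
  rewrite !integral_mix ?(ltW s0) ?(ltW sV0)// aE bE /= !mul1r mulr1.
  rewrite -EFinM lee_fin; apply.
  - by apply: bmix => //; rewrite lerDl ltW.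
  - by apply: bmix => //; rewrite lerDr ltW.
  - move=> x; rewrite -EFinM lee_fin; have /andP[h0 h1] := phi01 x.
    (* As [s + 1 / s >= 2], the product dominates [(phi + (1 - phi))^2 = 1]. *)
    have ssV2 : 2 <= s + s^-1 by have := sqr_ge0 (s - s^-1); rewrite !expr2; nra.
    have -> : (s * phi x + 1 * (1 - phi x)) * (s^-1 * phi x + 1 * (1 - phi x)) =
      s * s^-1 * phi x ^+ 2 + (s + s^-1) * (phi x * (1 - phi x)) +
      (1 - phi x) ^+ 2 by ring.
    have : 0 <= phi x * (1 - phi x) by rewrite mulr_ge0// subr_ge0.
    by rewrite ssV !expr2; nra.
by rewrite -sqrtr_sqr ler_wsqrtr.
Qed.

(** Indicators of events are tests, and the test bound is uniform over them. *)
Lemma tv_dist_le_affinity {d} {T : measurableType d} {R : realType}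
    (P Q : probability T R) (c : R) :
  affinity_sqr_ge P Q c -> (0 <= tv_dist P Q <= (Num.sqrt (1 - c))%:E)%E.
Proof.
move=> A; apply/andP; split.
  apply: (@le_trans _ _ `|P set0 - Q set0|%E); first exact: abse_ge0.
  by apply: ereal_sup_ubound; exists set0.
apply: ge_ereal_sup => _ [B mB <-].
rewrite -[P B](@expectation_indic _ _ _ P B mB).
rewrite -[Q B](@expectation_indic _ _ _ Q B mB).
apply: (affinity_sqr_ge_test A) => // x.
by rewrite indicE; case: (_ \in _) => /=; rewrite ?lexx ?ler01.
Qed.

(** * Quadratic mean differentiability and affinity of the powers *)

Lemma affinity_sqr_ge_le {d} {T : measurableType d} {R : realType}
    (P Q : probability T R) (c c' : R) :
  c' <= c -> affinity_sqr_ge P Q c -> affinity_sqr_ge P Q c'.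
Proof.
move=> cc A M K f g K0 mf mg fM gM fg; apply: le_trans (A M K f g _ _ _ _ _ _) => //.
by rewrite lee_fin ler_wpM2r.
Qed.

Lemma bernoulli_inequality {R : realDomainType} (y : R) (n : nat) :
  0 <= y <= 1 -> 1 - n%:R * y <= (1 - y) ^+ n.
Proof.
move=> /andP[y0 y1]; elim: n => [|n IH]; first by rewrite mul0r subr0 expr0.
rewrite exprS; apply: le_trans (ler_wpM2l _ IH); last by rewrite subr_ge0.
rewrite -natr1; have : 0 <= n%:R * y * y by rewrite !mulr_ge0.
by lra.
Qed.

(** The difference of roots is the remainder plus the linear term [h * score * sqrt q / 2]. After
    [(a + b)^2 <= 2 a^2 + 2 b^2], the remainder contributes [2 h^2] and the linear term
    [I0 h^2 / 2]. *)
Lemma hellinger_le_dqm {d} {T : measurableType d} {R : realType}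
    (mu : {measure set T -> \bar R}) (P Q : probability T R) (p q : T -> R)
    (score : T -> R) (h I0 : R) :
  is_density mu P p -> is_density mu Q q -> measurable_fun setT score ->
  fisher_information Q score = I0%:E ->
  (\int[mu]_x ((Num.sqrt (p x) - Num.sqrt (q x)
     - 2^-1 * h * score x * Num.sqrt (q x)) ^+ 2)%:E <= (h ^+ 2)%:E)%E ->
  (\int[mu]_x ((Num.sqrt (p x) - Num.sqrt (q x)) ^+ 2)%:E
     <= ((2 + I0 / 2) * h ^+ 2)%:E)%E.
Proof.
move=> [mp p0 _] dQ ms HI Hr; have [mq q0 _] := dQ.
have mq' : measurable_fun setT (EFin \o q) by exact/measurable_EFinP.
have msqrt (g : T -> R) : measurable_fun setT g ->
    measurable_fun setT (fun x => Num.sqrt (g x)).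
  by move=> mg; apply: measurableT_comp => //;
    apply: continuous_measurable_fun; exact: sqrt_continuous.
pose r x := (Num.sqrt (p x) - Num.sqrt (q x)
     - 2^-1 * h * score x * Num.sqrt (q x)) ^+ 2.
have mr : measurable_fun setT (fun x => (r x)%:E).
  apply/measurable_EFinP; apply: measurable_funX; apply: measurable_funB.
    by apply: measurable_funB; exact: msqrt.
  by apply: measurable_funM; [apply: measurable_funM|exact: msqrt].
have r0 x : (0 <= (r x)%:E)%E by rewrite lee_fin sqr_ge0.
have ms2 : measurable_fun setT (fun x => (score x ^+ 2)%:E).
  by apply/measurable_EFinP; exact: measurable_funX.
have s0 x : (0 <= (score x ^+ 2)%:E)%E by rewrite lee_fin sqr_ge0.
have msq : measurable_fun setT (fun x => (score x ^+ 2)%:E * (q x)%:E)%E.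
  exact: emeasurable_funM.
have sq0 x : (0 <= (score x ^+ 2)%:E * (q x)%:E)%E.
  by apply: mule_ge0 => //; rewrite lee_fin.
have k0 : 0 <= 2^-1 * h ^+ 2 by rewrite mulr_ge0 ?sqr_ge0 ?invr_ge0.
have mr2 : measurable_fun setT (fun x => 2%:E * (r x)%:E)%E.
  exact: emeasurable_funM.
have r20 x : (0 <= 2%:E * (r x)%:E)%E by apply: mule_ge0.
have msq2 : measurable_fun setT
    (fun x => (2^-1 * h ^+ 2)%:E * ((score x ^+ 2)%:E * (q x)%:E))%E.
  exact: emeasurable_funM.
have sq20 x : (0 <= (2^-1 * h ^+ 2)%:E * ((score x ^+ 2)%:E * (q x)%:E))%E.
  by apply: mule_ge0.
apply: (@le_trans _ _ (\int[mu]_x (2%:E * (r x)%:E +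
    (2^-1 * h ^+ 2)%:E * ((score x ^+ 2)%:E * (q x)%:E)))%E).
  apply: ge0_le_integral => //.
  - by move=> x _; rewrite lee_fin sqr_ge0.
  - apply/measurable_EFinP; apply: measurable_funX.
    by apply: measurable_funB; exact: msqrt.
  - exact: emeasurable_funD.
  - move=> x _; rewrite -!EFinM -EFinD lee_fin /r.
    rewrite -[in X in score x ^+ 2 * X](sqr_sqrtr (q0 x)).
    move: (Num.sqrt (p x)) (Num.sqrt (q x)) (score x) => u v s.
    (* (a + b)^2 <= 2 a^2 + 2 b^2 with b the linear term of the expansion *)
    have := sqr_ge0 (u - v - 2 * (2^-1 * h * s * v)); nra.
rewrite ge0_integralD// !ge0_integralZl_EFin//.
rewrite -(integral_density (fun x => (score x ^+ 2)%:E) dQ)//.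
have -> : (\int[Q]_x (score x ^+ 2)%:E = I0%:E)%E.
  by rewrite -HI /fisher_information expectation.unlock.
have -> : (((2 + I0 / 2) * h ^+ 2)%:E =
    2%:E * (h ^+ 2)%:E + (2^-1 * h ^+ 2)%:E * I0%:E)%E.
  by rewrite -!EFinM -EFinD; congr (_%:E); ring.
by rewrite leeD2r// lee_wpmul2l ?lee_fin.
Qed.

(** The radius [delta] is found for one observation and serves every [n], which is what allows [h]
    to vary with [n] later. *)
Lemma dqm_affinity_power {d} {T : measurableType d} {R : realType}
    {Theta : set R} {P : R -> probability T R} {score : T -> R} {I0 : R} :
  nbhs (0 : R) Theta -> quadratic_mean_differentiable_at0 Theta P score ->
  fisher_information (P 0) score = I0%:E -> 0 < I0 ->
  exists2 delta : R, 0 < delta & forall (n : nat) (h : R), 0 < `|h| < delta ->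
    affinity_sqr_ge (power_measure (P h) n) (power_measure (P 0) n)
      (1 - n%:R * ((2 + I0 / 2) * h ^+ 2)).
Proof.
move=> nTheta [ms [mu [p [p0 [dens lim0]]]]] HI I0_gt0.
set C := 2 + I0 / 2; have C0 : 0 < C by rewrite /C; lra.
have /fine_cvgP[fin_near fine_cvg] := lim0.
move/cvgr0Pnorm_lt : fine_cvg => /(_ _ ltr01) lt1.
(* This radius ensures [C * h ^+ 2 <= 2], as [affinity_sqr_ge_density] requires. *)
have small : \forall h \near (0 : R)^', `|h| < Num.sqrt (2 / C).
  by apply: dnbhs0_lt; rewrite sqrtr_gt0 divr_gt0.
have : \forall h \near (0 : R)^', forall n : nat,
    affinity_sqr_ge (power_measure (P h) n) (power_measure (P 0) n)
      (1 - n%:R * (C * h ^+ 2)).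
  near=> h => n.
  have h0 : h != 0 by near: h; exact: nbhs_dnbhs_neq.
  have [d1 d2] : is_density (mu h) (P h) (p h) /\ is_density (mu h) (P 0) (p0 h).
    by apply: dens; near: h; exact: nbhs_dnbhs.
  have h20 : 0 < h ^+ 2 by rewrite exprn_even_gt0.
  have e2 : C * h ^+ 2 <= 2.
    rewrite mulrC -ler_pdivlMr// -[leRHS]sqr_sqrtr; last by rewrite divr_ge0// ltW.
    rewrite -real_normK ?num_real// ler_pXn2r ?nnegrE ?sqrtr_ge0// ltW//.
    by near: h.
  have He := @hellinger_le_dqm _ _ _ _ _ _ _ _ score h I0 d1 d2 ms HI.
  have aff1 : affinity_sqr_ge (P h) (P 0) ((1 - C * h ^+ 2 / 2) ^+ 2).
    apply: (affinity_sqr_ge_density d1 d2 e2); apply: He.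
    set J := (\int[_]_x _)%E.
    have finJ : ((h ^- 2)%:E * J)%E \is a fin_num by rewrite /J; near: h.
    have lt1J : `|fine ((h ^- 2)%:E * J)%E| < 1 by rewrite /J; near: h.
    have -> : J = ((h ^+ 2)%:E * ((h ^- 2)%:E * J))%E.
      by rewrite muleA -EFinM divff ?mul1e// gt_eqF.
    rewrite -(fineK finJ) -EFinM lee_fin ler_piMr ?sqr_ge0//.
    exact: le_trans (ler_norm _) (ltW lt1J).
  apply: affinity_sqr_ge_le (affinity_sqr_ge_power _ _ _ n (sqr_ge0 _) aff1).
  (* The one-observation bound is itself a square, hence Bernoulli's inequality with exponent
     [2 * n] and [y = C h^2 / 2]. *)
  rewrite -exprM; apply: le_trans (bernoulli_inequality _ (2 * n) _).
    by rewrite natrM; lra.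
  by rewrite ler_pdivrMr// mul1r e2 divr_ge0// mulr_ge0// ltW.
move=> /nbhs_ballP[delta /= delta0 Hdelta]; exists delta => // n h /andP[h0 hd].
apply: Hdelta; last by rewrite -normr_gt0.
by rewrite /ball/= sub0r normrN.
Unshelve. all: by end_near. Qed.

(** * Two-point bounds on the minimax risk *)

(** Below, each supremum is at least its value at [t0] or [t1], and no test separates these two laws
    by more than [sqrt(1 - c)]. Above, the test that never rejects is used. *)
Lemma minimax_risk_bounds {d} {T : measurableType d} {R : realType}
    (P : R -> probability T R) (n : nat) (null alt : set R) (t0 t1 c : R) :
  null t0 -> alt t1 ->
  affinity_sqr_ge (power_measure (P t1) n) (power_measure (P t0) n) c ->
  ((1 - Num.sqrt (1 - c))%:E <= minimax_risk P n null alt <= 1)%E.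
Proof.
move=> null0 alt1 A; apply/andP; split.
  apply: le_ereal_inf_tmp => _ [phi [mphi phi01] <-].
  have [a a01 [aE _]] := expectation_test (power_measure (P t0) n) mphi phi01.
  have [b b01 [bE bE']] := expectation_test (power_measure (P t1) n) mphi phi01.
  have := affinity_sqr_ge_test A mphi phi01.
  rewrite aE bE -EFinB lee_fin => /ler_normlP[_ le_dist].
  apply: (@le_trans _ _ (a%:E + (1 - b)%:E)%E).
    by rewrite -EFinD lee_fin; lra.
  apply: leeD; apply: ereal_sup_ubound; first by exists t0.
  by exists t1.
pose phi0 (x : n.-tuple T) : R := 0.
apply: (@le_trans _ _ (ereal_sup [set 'E_(power_measure (P theta) n)[phi0]
      | theta in null] +
    ereal_sup [set 'E_(power_measure (P theta) n)[fun x => (1 - phi0 x)%R]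
      | theta in alt])%E).
  apply: ereal_inf_lbound; exists phi0 => //; split; first exact: measurable_cst.
  by move=> x; rewrite lexx ler01.
rewrite -[leRHS]add0e; apply: leeD; apply: ge_ereal_sup => _ [t _ <-].
  by rewrite expectation_cst.
by rewrite -[leRHS](expectation_cst (power_measure (P t) n) 1) /phi0 subr0.
Qed.

(** * Parameter sequences negligible at the scale [1 / sqrt n] *)

Lemma cvg0_of_sqrtn_cvg0 {R : realType} {u : nat -> R} :
  Num.sqrt n%:R * u n @[n --> \oo] --> (0 : R) ->
  u n @[n --> \oo] --> (0 : R).
Proof.
move=> /cvgr0Pnorm_lt lim0; apply/cvgr0Pnorm_lt => delta delta0.
have small := lim0 _ delta0; near=> n.
have n0 : (0 < n)%N by near: n; exact: nbhs_infty_gt.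
have : `|Num.sqrt n%:R * u n| < delta by near: n.
apply: le_lt_trans; rewrite normrM (ger0_norm (sqrtr_ge0 _)) ler_peMl//.
by rewrite -[leLHS]sqrtr1 ler_wsqrtr// ler1n.
Unshelve. all: by end_near. Qed.

Lemma local_alternative_affinity {d} {T : measurableType d} {R : realType}
    {Theta : set R} {P : R -> probability T R} {score : T -> R} {I0 : R}
    (theta : nat -> R) :
  nbhs (0 : R) Theta -> quadratic_mean_differentiable_at0 Theta P score ->
  fisher_information (P 0) score = I0%:E -> 0 < I0 ->
  (forall n, (0 < n)%N -> theta n != 0) ->
  Num.sqrt n%:R * theta n @[n --> \oo] --> (0 : R) ->
  exists2 e : nat -> R, e n @[n --> \oo] --> (0 : R) & \forall n \near \oo,
    affinity_sqr_ge (power_measure (P (theta n)) n) (power_measure (P 0) n)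
      (1 - e n ^+ 2).
Proof.
move=> nTheta dqm HI I0_gt0 theta0 lim0.
have [delta delta0 H] := dqm_affinity_power nTheta dqm HI I0_gt0.
set C := 2 + I0 / 2 in H; have C0 : 0 <= C by rewrite /C; lra.
(* Chosen so that [e n ^+ 2] is [n C theta_n^2]: the later bound [sqrt(1 - c)] is then exactly
   [|e n|]. *)
exists (fun n => Num.sqrt C * (Num.sqrt n%:R * theta n)).
  by rewrite -[X in _ --> X](mulr0 (Num.sqrt C)); apply: cvgM => //; exact: cvg_cst.
have /cvgr0Pnorm_lt/(_ _ delta0) small := cvg0_of_sqrtn_cvg0 lim0.
near=> n.
have n0 : (0 < n)%N by near: n; exact: nbhs_infty_gt.
rewrite !exprMn !sqr_sqrtr// mulrCA; apply: H.
by rewrite normr_gt0 theta0//=; near: n.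
Unshelve. all: by end_near. Qed.

(** The spaces depend on [n] because the sample size does. The distance is squeezed between 0 and
    [|e n|]. *)
Lemma tv_dist_cvg0 {d : nat -> measure_display}
    {T : forall n, measurableType (d n)} {R : realType}
    (P Q : forall n, probability (T n) R) (e : nat -> R) :
  e n @[n --> \oo] --> (0 : R) ->
  (\forall n \near \oo, affinity_sqr_ge (P n) (Q n) (1 - e n ^+ 2)) ->
  tv_dist (P n) (Q n) @[n --> \oo] --> 0%E.
Proof.
move=> e0 A; apply: (@squeeze_cvge _ _ _ _ (cst 0%E) _ (fun n => `|e n|%:E)).
- near=> n; have An : affinity_sqr_ge (P n) (Q n) (1 - e n ^+ 2) by near: n.
  by have := tv_dist_le_affinity _ _ _ An; rewrite subKr sqrtr_sqr.
- exact: cvg_cst.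
- by apply: cvg_EFin; [exact: nearW|exact/norm_cvg0P].
Unshelve. all: by end_near. Qed.

Theorem mainTheorem2 (d : measure_display) (T : measurableType d) (R : realType)
    (Theta : set R) (P : R -> probability T R) (score : T -> R)
    (I0 eps : R) (Delta : nat -> R)
    (hTheta : nbhs (0 : R) Theta)
    (hdqm : quadratic_mean_differentiable_at0 Theta P score)
    (hI0 : fisher_information (P 0) score = I0%:E)
    (I0_gt0 : 0 < I0)
    (Delta_gt0 : forall n : nat, (0 < n)%N -> 0 < Delta n)
    (hlambda : Num.sqrt (n%:R * I0) * Delta n @[n --> \oo] --> (0 : R))
    (heps : 0 < eps < 1) :
  (* (i) *)
  minimax_risk P n (near_null Theta eps (Delta n))
      (far_alternative Theta eps (Delta n)) @[n --> \oo] --> 1%E /\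
  (* (ii) *)
  tv_dist (power_measure (P ((1 + eps) * Delta n)) n) (power_measure (P 0) n)
      @[n --> \oo] --> 0%E /\
  (* (iii) *)
  (let b := fun n : nat => (Num.sqrt n%:R * Delta n) `^ (- 2^-1) in
   let theta := fun n : nat => b n * Delta n in
   `|theta n| / Delta n @[n --> \oo] --> +oo /\
   tv_dist (power_measure (P (theta n)) n) (power_measure (P 0) n)
      @[n --> \oo] --> 0%E).
Proof.
have /andP[eps0 eps1] := heps.
have lim_sqrt : Num.sqrt n%:R * Delta n @[n --> \oo] --> (0 : R).
  have sI0 : Num.sqrt I0 != 0 by rewrite gt_eqF// sqrtr_gt0.
  have -> : (fun n => Num.sqrt n%:R * Delta n) =
      (fun n => (Num.sqrt I0)^-1 * (Num.sqrt (n%:R * I0) * Delta n)).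
    by apply/funext => n; rewrite sqrtrM// -mulrA (mulrCA (Num.sqrt n%:R)) mulKf.
  rewrite -[X in _ --> X](mulr0 (Num.sqrt I0)^-1).
  by apply: cvgM => //; exact: cvg_cst.
have lim_ii : Num.sqrt n%:R * ((1 + eps) * Delta n) @[n --> \oo] --> (0 : R).
  have -> : (fun n => Num.sqrt n%:R * ((1 + eps) * Delta n)) =
      (fun n => (1 + eps) * (Num.sqrt n%:R * Delta n)).
    by apply/funext => n; rewrite mulrCA.
  rewrite -[X in _ --> X](mulr0 (1 + eps)).
  by apply: cvgM => //; exact: cvg_cst.
(* The alternatives are restricted to [Theta], so the second of the two points must be shown to lie
   there eventually. *)
have near_Theta : \forall n \near \oo, Theta ((1 + eps) * Delta n).
  by have := cvg0_of_sqrtn_cvg0 lim_ii; apply.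
have far_neq0 n : (0 < n)%N -> (1 + eps) * Delta n != 0.
  by move=> n0; rewrite gt_eqF// mulr_gt0 ?Delta_gt0//; lra.
have [e e_cvg He] :=
  local_alternative_affinity _ hTheta hdqm hI0 I0_gt0 far_neq0 lim_ii.
split; last split.
- apply: (@squeeze_cvge _ _ _ _ (fun n => (1 - `|e n|)%:E) _ (cst 1%E)); last 2 first.
  + rewrite -[X in _ --> X]/(1%:E) -[X in _ --> X%:E]subr0.
    apply: cvg_EFin; first exact: nearW.
    by apply: cvgB; [exact: cvg_cst|exact/norm_cvg0P].
  + exact: cvg_cst.
  + near=> n; have n0 : (0 < n)%N by near: n; exact: nbhs_infty_gt.
    have D0 := Delta_gt0 n n0.
    have Theta_far : Theta ((1 + eps) * Delta n).
      by near: n; exact: near_Theta.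
    have -> : `|e n| = Num.sqrt (1 - (1 - e n ^+ 2)) by rewrite subKr sqrtr_sqr.
    apply: (@minimax_risk_bounds _ _ _ _ _ _ _ 0 ((1 + eps) * Delta n)).
    * split; first exact: nbhs_singleton.
      by rewrite normr0 mulr_ge0 ?(ltW D0)//; lra.
    * by split => //; rewrite ger0_norm// mulr_ge0 ?(ltW D0)//; lra.
    * by near: n.
- exact: tv_dist_cvg0 e_cvg He.
- move=> b theta.
  have x0 n : (0 < n)%N -> 0 < Num.sqrt n%:R * Delta n.
    by move=> n0; rewrite mulr_gt0 ?Delta_gt0// sqrtr_gt0 ltr0n.
  (* Writing [x = sqrt n * Delta n], one has [b n = 1 / sqrt x]. *)
  have bE n : (0 < n)%N -> b n = (Num.sqrt (Num.sqrt n%:R * Delta n))^-1.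
    by move=> n0; rewrite /b powRN powR12_sqrt// ltW// x0.
  have lim_root : Num.sqrt (Num.sqrt n%:R * Delta n) @[n --> \oo] --> (0 : R).
    rewrite -[X in _ --> X](sqrtr0 R).
    by apply: continuous_cvg => //; exact: sqrt_continuous.
  have b0 n : (0 < n)%N -> 0 < b n.
    by move=> n0; rewrite bE// invr_gt0 sqrtr_gt0 x0.
  split.
    (* The ratio [|theta n| / Delta n] equals [b n], the inverse of a positive sequence tending to
       0. *)
    have : (Num.sqrt (Num.sqrt n%:R * Delta n))^-1 @[n --> \oo] --> +oo.
      apply/cvgrVy => //; near=> n; rewrite sqrtr_gt0 x0//.
      by near: n; exact: nbhs_infty_gt.
    apply: cvg_trans; apply: near_eq_cvg; near=> n.
    have n0 : (0 < n)%N by near: n; exact: nbhs_infty_gt.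
    rewrite /theta normrM !ger0_norm ?ltW ?b0 ?Delta_gt0// mulfK ?bE//.
    by rewrite gt_eqF ?Delta_gt0.
  have theta_neq0 n : (0 < n)%N -> theta n != 0.
    by move=> n0; rewrite gt_eqF// mulr_gt0 ?b0 ?Delta_gt0.
  (* Here [sqrt n * theta n = x / sqrt x = sqrt x], which still tends to 0. *)
  have lim_iii : Num.sqrt n%:R * theta n @[n --> \oo] --> (0 : R).
    move: lim_root; apply: cvg_trans; apply: near_eq_cvg; near=> n.
    have n0 : (0 < n)%N by near: n; exact: nbhs_infty_gt.
    rewrite /theta mulrCA bE//; have := x0 n n0.
    move: (_ * _) => x x_gt0.
    have := sqr_sqrtr (ltW x_gt0); rewrite expr2.
    have : Num.sqrt x != 0 by rewrite gt_eqF// sqrtr_gt0.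
    by move: (Num.sqrt x) => y y0 <-; rewrite mulKf.
  have [e3 e3_cvg H3] :=
    local_alternative_affinity _ hTheta hdqm hI0 I0_gt0 theta_neq0 lim_iii.
  exact: tv_dist_cvg0 e3_cvg H3.
Unshelve. all: by end_near. Qed.
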